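(* Let $\varepsilon>0$, $\Omega_0>0$, and $\hat\alpha,\Delta,\Omega,\hat P_N,\kappa,q\in\mathbb R$ with $\kappa q\neq0$. Assume that $\hat\alpha>0$. Then the nontrivial relative equilibrium (the one with $z\ne0$) of the system $$\begin{cases}\dot z=i\Omega_0z+\varepsilon\Bigl(\bigl(i\Delta-\tfrac{\hat\alpha}{2}\bigr)z-\dfrac{\kappa q}{2\Omega_0}e^{i\psi}\Bigr),\\ \dot\psi=\Omega_0+\varepsilon w,\\ \dot w=\varepsilon\bigl(\hat P_N-\hat\alpha(\Omega+w)\bigr)\end{cases}$$ on $X=\mathbb C\times\mathbb S^1\times\mathbb R$, namely the $R_\theta$-orbit of the point $u^\Sigma=(x^*,\psi^*,w^* )$ described in the context, is transversely asymptotically stable.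
   Context: $\mathbb S^1=\mathbb R/2\pi\mathbb Z$. The symmetry action is $R_\theta(z,\psi,w)=(e^{i\Omega_0\theta}z,\psi+\Omega_0\theta,w)$, $\theta\in\mathbb R$, under which the system is equivariant. A point $u^*$ is a relative equilibrium with group velocity $\xi\in\mathbb R$ if its solution satisfies $\Phi_t(u^* )=R_{\xi t}(u^* )$ for all $t\in\mathbb R$. The nontrivial relative equilibrium is the orbit $\{R_\theta(u^\Sigma):\theta\in\mathbb R\}$ of $u^\Sigma=(x^*,\psi^*,w^* )$, with group velocity $\xi=1+\frac{\varepsilon}{\Omega_0}w^*$, where $$w^*=\frac{\hat P_N}{\hat\alpha}-\Omega,\quad S=\sqrt{\hat\alpha^2+4(w^*-\Delta)^2},\quad x^*=\frac{|\kappa q|}{\Omega_0S}>0,\quad \cos\psi^*=-\operatorname{sgn}(\kappa q)\frac{\hat\alpha}{S},\quad \sin\psi^*=-\operatorname{sgn}(\kappa q)\frac{2(w^*-\Delta)}{S}.$$ Transversely asymptotically stable means asymptotically stable modulo the circle symmetry: the group orbit $\mathcal O=\{R_\theta(u^\Sigma):\theta\in\mathbb R\}$ is an asymptotically stable invariant set, i.e. for every neighbourhood $U$ of $\mathcal O$ there is a neighbourhood $V$ of $\mathcal O$ such that solutions starting in $V$ stay in $U$ for all $t\ge0$, and $V$ can be chosen such that moreover the distance of these solutions to $\mathcal O$ tends to $0$ as $t\to\infty$. *)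

(* Defs.v *)
From HB Require Import structures.
From mathcomp Require Import all_boot all_order all_algebra generic_quotient.
From mathcomp Require Import ring_quotient complex ring.
From mathcomp Require Import all_classical all_reals all_analysis.

Set Implicit Arguments.
Unset Strict Implicit.
Unset Printing Implicit Defensive.

Import Order.TTheory GRing.Theory Num.Theory.
Import numFieldNormedType.Exports.

Local Open Scope classical_set_scope.
Local Open Scope ring_scope.
Local Open Scope quotient_scope.

(* [Rcomplex R] is R[i] seen as an R-module; mathcomp.real_closed already
   gives it its R-valued norm, from which the metric below is induced. It is
   not the topology of R[i] as a numFieldType, whose radii live in R[i]. *)
Section Rcomplex_normed.
Context {R : rcfType}.

HB.instance Definition _ :=
  PseudoMetric.copy (Rcomplex R) (pseudoMetric_normed (Rcomplex R)).
HB.instance Definition _ := isPointed.Build (Rcomplex R) 0.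
HB.instance Definition _ :=
  NormedZmod_PseudoMetric_eq.Build R (Rcomplex R) erefl.

Lemma Rcomplex_normrZ (l : R) (x : Rcomplex R) : `|l *: x| = `|l| * `|x|.
Proof.
case: x => a b; rewrite /Num.norm /= !exprMn -mulrDr sqrtrM ?sqr_ge0//.
by rewrite sqrtr_sqr.
Qed.

HB.instance Definition _ :=
  PseudoMetricNormedZmod_Lmodule_isNormedModule.Build R (Rcomplex R)
    Rcomplex_normrZ.

End Rcomplex_normed.

Definition twopiZ (R : realType) : {pred R} :=
  fun x => `[< exists k : int, x = (pi *+ 2) *~ k >].

Lemma twopiZ_zmod_closed (R : realType) : zmod_closed (@twopiZ R).
Proof.
split; first by apply/asboolP; exists 0; rewrite mulr0z.
move=> x y /asboolP[k ->] /asboolP[l ->]; apply/asboolP; exists (k - l).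
by rewrite mulrzBr.
Qed.

HB.instance Definition _ (R : realType) :=
  GRing.isZmodClosed.Build R (@twopiZ R) (twopiZ_zmod_closed R).

Definition circle (R : realType) : Type := Quotient.quot (@twopiZ R).

Section circle_structures.
Context {R : realType}.

HB.instance Definition _ := GRing.Zmodule.on (circle R).
HB.instance Definition _ := EqQuotient.on (circle R).

Definition to_circle (x : R) : circle R := \pi_(circle R) x.

Lemma to_circle_eqP (x y : R) :
  to_circle x = to_circle y <-> exists k : int, x - y = (pi *+ 2) *~ k.
Proof.
rewrite /to_circle; split=> [/eqP|xy].
  by rewrite -Quotient.idealrBE => /asboolP.
by apply/eqP; rewrite -Quotient.idealrBE; apply/asboolP.
Qed.

(* Quotient (arc-length) metric: the distance of two points is the infimum of
   the distances of their real representatives. *)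
Definition circle_ball (p : circle R) (e : R) (p' : circle R) : Prop :=
  exists x y : R, [/\ to_circle x = p, to_circle y = p' & `|x - y| < e].

Lemma circle_ball_center p (e : R) : 0 < e -> circle_ball p e p.
Proof.
move=> e0; exists (repr p), (repr p).
by rewrite subrr normr0; split=> //; exact: reprK.
Qed.

Lemma circle_ball_sym p p' (e : R) : circle_ball p e p' -> circle_ball p' e p.
Proof. by move=> [x [y [? ? ?]]]; exists y, x; rewrite distrC. Qed.

Lemma circle_ball_triangle p1 p2 p3 (e1 e2 : R) :
  circle_ball p1 e1 p2 -> circle_ball p2 e2 p3 -> circle_ball p1 (e1 + e2) p3.
Proof.
move=> [x [y [xp yp xy]]] [y' [z [y'p zp yz]]].
have /to_circle_eqP[k yy'] : to_circle y = to_circle y' by rewrite yp y'p.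
exists x, (z + (y - y')); split => //.
  rewrite -zp; apply/to_circle_eqP; exists k.
  by rewrite -yy' addrAC subrr add0r.
rewrite (_ : x - _ = (x - y) + (y' - z)).
  by rewrite (le_lt_trans (ler_normD _ _))// ltrD.
by ring.
Qed.

Definition circle_ent : set_system (circle R * circle R) :=
  entourage_ circle_ball.

HB.instance Definition _ := hasNbhs.Build (circle R) (nbhs_ circle_ent).
HB.instance Definition _ := @Nbhs_isPseudoMetric.Build R (circle R)
  circle_ent erefl circle_ball circle_ball_center circle_ball_sym
  circle_ball_triangle erefl.

(* The metric topology is the quotient topology of R/2piZ. *)
Lemma circle_openE (A : set (circle R)) : open A <-> open (to_circle @^-1` A).
Proof.
rewrite !openE; split=> [oA x /= Ax|oA p Ap].
  have /nbhs_ballP[e /= e0 eA] := oA _ Ax.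
  apply/nbhs_ballP; exists e => // y xy; apply: eA.
  by exists x, y; split.
have /= Ar : A (to_circle (repr p)) by rewrite /to_circle reprK.
have /nbhs_ballP[e /= e0 eA] := oA _ Ar.
apply/nbhs_ballP; exists e => // p' [x [y [xp yp xy]]].
have /to_circle_eqP[k rx] : to_circle (repr p) = to_circle x.
  by rewrite xp; exact: reprK.
have -> : p' = to_circle (y + (repr p - x)).
  rewrite -yp; apply/esym/to_circle_eqP; exists k.
  by rewrite -rx addrAC subrr add0r.
apply: eA; rewrite /ball /= (_ : _ - _ = x - y)//.
by ring.
Qed.

End circle_structures.

Section dynamics.
Context {R : realType}.
Implicit Types (theta t : R).

Definition phase_space : Type := (Rcomplex R * circle R * R)%type.
Definition tangent : Type := (Rcomplex R * R * R)%type.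

Definition expi (a : R) : R[i] := (cos a +i* sin a)%C.
Definition circle_expi (psi : circle R) : R[i] := expi (repr psi).

Lemma expi_periodic (a : R) (k : int) : expi (a + (pi *+ 2) *~ k) = expi a.
Proof.
wlog kE : a k / exists n : nat, k = n => [hw|].
  case: k => n; first by apply: hw; exists n.
  rewrite -(hw (a + (pi *+ 2) *~ Negz n) n.+1); last by exists n.+1.
  by rewrite NegzE mulrNz subrK.
case: kE => n ->; rewrite -pmulrn /expi.
by rewrite (periodicn (@cosD2pi R)) (periodicn (@sinD2pi R)).
Qed.

Lemma circle_expiE (a : R) : circle_expi (to_circle a) = expi a.
Proof.
have /to_circle_eqP[k ak] : to_circle (repr (to_circle a)) = to_circle a.
  by rewrite /to_circle reprK.
by rewrite /circle_expi -(subrK a (repr _)) ak addrC expi_periodic.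
Qed.

(* Velocity of a curve in R/2piZ, read in a local lift to R. *)
Definition circle_is_derive (t : R) (psi : R -> circle R) (v : R) : Prop :=
  exists2 phi : R -> R,
    \forall s \near t, psi s = to_circle (phi s) & is_derive t 1 phi v.

Definition is_solution (F : phase_space -> tangent) (u : R -> phase_space) :=
  forall t, [/\ is_derive t 1 (fun s => (u s).1.1) (F (u t)).1.1,
    circle_is_derive t (fun s => (u s).1.2) (F (u t)).1.2 &
    is_derive t 1 (fun s => (u s).2) (F (u t)).2].

(* Every initial condition has exactly one solution, which exists for all
   times and is given by Phi. *)
Definition is_flow (F : phase_space -> tangent)
    (Phi : R -> phase_space -> phase_space) : Prop :=
  (forall u0, Phi 0 u0 = u0) /\
  (forall u, is_solution F u <-> forall t, u t = Phi t (u 0)).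

Definition rotation (Omega0 theta : R) (u : phase_space) : phase_space :=
  let: (z, psi, w) := u in
  (expi (Omega0 * theta) * z, psi + to_circle (Omega0 * theta), w).

Definition group_orbit (Omega0 : R) (u : phase_space) : set phase_space :=
  [set rotation Omega0 theta u | theta in setT].

Definition relative_equilibrium (Omega0 : R)
    (Phi : R -> phase_space -> phase_space) (xi : R) (u : phase_space) : Prop :=
  forall t, Phi t u = rotation Omega0 (xi * t) u.

Definition asymptotically_stable_set (Phi : R -> phase_space -> phase_space)
    (O : set phase_space) : Prop :=
  (forall t, Phi t @` O = O) /\
  forall U, set_nbhs O U -> exists2 V, set_nbhs O V &
    forall v, V v -> (forall t, 0 <= t -> U (Phi t v)) /\
      edist_inf O (Phi t v) @[t --> +oo] --> 0%E.

Definition transversely_asymptotically_stable (Omega0 : R)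
    (Phi : R -> phase_space -> phase_space) (u : phase_space) : Prop :=
  asymptotically_stable_set Phi (group_orbit Omega0 u).

Definition vector_field (eps Omega0 alpha Delta Omega PN kappa q : R)
    (u : phase_space) : tangent :=
  let: (z, psi, w) := u in
  ('i%C * Omega0%:C%C * z
     + eps%:C%C * (('i%C * Delta%:C%C - (alpha / 2)%:C%C) * z
        - (kappa * q / (2 * Omega0))%:C%C * circle_expi psi),
   Omega0 + eps * w,
   eps * (PN - alpha * (Omega + w))).

End dynamics.
Arguments phase_space : clear implicits.
Arguments tangent : clear implicits.

(* Main.v *)
Require Import Defs.
From HB Require Import structures.
From mathcomp Require Import all_boot all_order all_algebra generic_quotient.
From mathcomp Require Import ring_quotient complex ring.
From mathcomp Require Import all_classical all_reals all_analysis.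

Set Implicit Arguments.
Unset Strict Implicit.
Unset Printing Implicit Defensive.

Import Order.TTheory GRing.Theory Num.Theory.
Import numFieldNormedType.Exports.

Local Open Scope classical_set_scope.
Local Open Scope ring_scope.

(* In the frame rotating with psi, z differs from its equilibrium value by a
   vector Z = (X, Y) which decays at rate a = eps * alpha / 2 and is forced only
   by v = w - wS, where v' = - 2 a v.  Hence L = |Z|^2 + (1 + k^2) v^2, with
   k = eps * xS / a, satisfies L' <= - a L along solutions, and sqrt L bounds
   the distance to the group orbit.  The flow exists globally by variation of
   constants; it is unique because psi lifts to R and the difference of two
   solutions in z is a pure damped rotation. *)

Local Notation Re := complex.Re.
Local Notation Im := complex.Im.

Section preliminaries.
Context {R : realType}.

(** * Angles modulo 2 pi *)

Lemma mod2pi (x : R) :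
  exists (k : int) (y : R), x = y + (pi *+ 2) *~ k /\ 0 <= y < pi *+ 2.
Proof.
have pi2_gt0 : 0 < pi *+ 2 :> R by rewrite pmulrn_lgt0// pi_gt0.
have /andP[] := floor_itv (x / (pi *+ 2)).
rewrite ler_pdivlMr// ltr_pdivrMr// intrD mulrDl mul1r mulrzl => kx xk.
exists (Num.floor (x / (pi *+ 2))), (x - (pi *+ 2) *~ Num.floor (x / (pi *+ 2))).
by rewrite subrK subr_ge0 kx ltrBlDr addrC.
Qed.

Lemma cos_eq1 (x : R) : cos x = 1 -> exists k : int, x = (pi *+ 2) *~ k.
Proof.
have [k [y [xE /andP[y_ge0 y_lt]]]] := mod2pi x => cosx; exists k.
have cosy : cos y = cos 0 by rewrite cos0 -cosx xE; have [-> _] := expi_periodic y k.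
suff y0 : y = 0 by rewrite xE y0 add0r.
have [ypi|piy] := leP y pi.
  by apply: cos_inj cosy; rewrite in_itv/= ?lexx ?pi_ge0// y_ge0.
(* Reflection brings the upper half of the period back to [0, pi], where cos is injective; it would
   force y = 2 pi, which the half-open period excludes. *)
have : pi *+ 2 - y = 0.
  apply: cos_inj; rewrite ?in_itv/= ?lexx ?pi_ge0//.
    by rewrite subr_ge0 ltW//= lerBlDr mulr2n lerD2l ltW.
  by rewrite addrC cosD2pi cosN.
by move/eqP; rewrite subr_eq0 => /eqP yE; rewrite yE ltxx in y_lt.
Qed.

(** Equal sines and cosines give cos (a - b) = 1, so [cos_eq1] applies. Points of the circle can
    thus be compared without reference to the chosen representatives. *)
Lemma expi_eq (a b : R) : expi a = expi b <-> to_circle a = to_circle b.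
Proof.
split=> [[cab sab]|/to_circle_eqP[k abk]].
  apply/to_circle_eqP/cos_eq1.
  by rewrite cosB cab sab -!expr2 cos2Dsin2.
by rewrite -(subrK b a) addrC abk expi_periodic.
Qed.

(** * Antiderivatives and derivatives of plane curves *)

Lemma continuous_antiderivative (f : R -> R) : continuous f ->
  exists F : R -> R, forall t : R, is_derive t 1 F (f t).
Proof.
move=> cf; pose mu := @lebesgue_measure R.
have intf a b : mu.-integrable `]a, b] (EFin \o f).
  apply: (@integrableS _ _ _ mu `[a, b]) => //; first exact: subset_itv_oc_cc.
  apply: continuous_compact_integrable; first exact: segment_compact.
  by apply: continuous_subspaceT.
pose I a b := (\int[mu]_(s in `]a, b]) f s)%R.
exists (fun t => if 0 <= t then I 0 t else - I t 0) => t.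
(* The signed integral from 0 changes form at 0. Near t it differs by a constant from the integral
   with lower endpoint -N < t, to which the fundamental theorem applies directly. *)
pose N := `|t| + 1.
have tN : `|t| < N by rewrite ltrDl.
have N_gt0 : 0 < N by rewrite (le_lt_trans _ tN).
have IB x y : - N <= x -> x <= y -> I (- N) y - I (- N) x = I x y.
  by move=> Nx xy; rewrite /I Rintegral_itvB// bnd_simp.
have FE : \forall s \near t, I (- N) s - I (- N) 0 =
    if 0 <= s then I 0 s else - I s 0.
  have sN : \forall s \near t, - N < s.
    by apply: lt_nbhsr; rewrite ltrNl (le_lt_trans _ tN)// -normrN ler_norm.
  apply: filterS sN => s Ns.
  case: ifPn => [s0|]; first by rewrite IB// oppr_le0 ltW.
  by rewrite -ltNge => s0; rewrite -(IB s 0) ?opprB// ltW.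
apply: (near_eq_is_derive FE).
have Nt : - N < t by rewrite ltrNl (le_lt_trans _ tN)// -normrN ler_norm.
have [||||dI dIE] := @continuous_FTC1 R f (BRight (- N)) t (t + 1).
- by rewrite ltrDl.
- exact: intf.
- exact: Nt.
- exact: cf.
have dG : is_derive t 1 (I (- N)) (f t) by apply: DeriveDef; rewrite -?derive1E.
by apply: is_derive_eq; rewrite subr0.
Qed.

Lemma is_derive_linear (V W : normedModType R) (L : {linear V -> W})
    (f : R -> V) (t : R) (v : V) :
  continuous L -> is_derive t 1 f v -> is_derive t 1 (L \o f) (L v).
Proof.
move=> cL [/derivable1_diffP df <-].
have dL x : differentiable L x by exact: linear_differentiable.
apply: DeriveDef; first exact/derivable1_diffP/differentiable_comp.
rewrite deriveE; last exact: differentiable_comp.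
by rewrite (diff_comp df (dL _)) /= (diff_lin _ cL) deriveE.
Qed.

Lemma is_derive_scalel (V : normedModType R) (f : R -> R) (t df : R) (v : V) :
  is_derive t 1 f df -> is_derive t 1 (fun s => f s *: v) (df *: v).
Proof.
move=> [/derivable1_diffP dif <-].
apply: DeriveDef; first exact/derivable1_diffP/differentiableZl.
rewrite deriveE; last exact: differentiableZl.
by rewrite diffZl//= deriveE.
Qed.

Lemma nonexpansive_linear_continuous (V W : normedModType R)
    (L : {linear V -> W}) : (forall z, `|L z| <= `|z|) -> continuous L.
Proof.
move=> Lz z; apply/cvgrPdist_lt => e e0; near=> w.
by rewrite -raddfB (le_lt_trans (Lz _))//; near: w; exact: cvgr_dist_lt.
Unshelve. all: by end_near. Qed.

Lemma Rcomplex_normE (z : Rcomplex R) :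
  `|z| = Num.sqrt (Re z ^+ 2 + Im z ^+ 2).
Proof. by case: z. Qed.

Lemma ler_Re_norm (z : Rcomplex R) : `|Re z| <= `|z|.
Proof.
by rewrite Rcomplex_normE -sqrtr_sqr ler_wsqrtr// lerDl sqr_ge0.
Qed.

Lemma ler_Im_norm (z : Rcomplex R) : `|Im z| <= `|z|.
Proof.
by rewrite Rcomplex_normE -sqrtr_sqr ler_wsqrtr// lerDr sqr_ge0.
Qed.

Lemma continuous_Re : continuous (@Re R : Rcomplex R -> R).
Proof. exact: (nonexpansive_linear_continuous ler_Re_norm). Qed.

Lemma continuous_Im : continuous (@Im R : Rcomplex R -> R).
Proof. exact: (nonexpansive_linear_continuous ler_Im_norm). Qed.

Lemma is_derive_Re (f : R -> Rcomplex R) (t : R) (v : Rcomplex R) :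
  is_derive t 1 f v -> is_derive t 1 (fun s => Re (f s)) (Re v).
Proof. exact: (is_derive_linear continuous_Re). Qed.

Lemma is_derive_Im (f : R -> Rcomplex R) (t : R) (v : Rcomplex R) :
  is_derive t 1 f v -> is_derive t 1 (fun s => Im (f s)) (Im v).
Proof. exact: (is_derive_linear continuous_Im). Qed.

Lemma is_derive_complex (x y : R -> R) (t dx dy : R) :
  is_derive t 1 x dx -> is_derive t 1 y dy ->
  is_derive t 1 (fun s => (x s +i* y s)%C : Rcomplex R) (dx +i* dy)%C.
Proof.
move=> xdx ydy.
have E (a b : R) : (a +i* b)%C = a *: (1 : Rcomplex R) + b *: ('i%C : Rcomplex R).
  by apply/eqP; rewrite eq_complex /= ; apply/andP; split; apply/eqP; ring.
rewrite (_ : (fun _ => _) = (fun s => x s *: (1 : Rcomplex R)) +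
    (fun s => y s *: ('i%C : Rcomplex R))); last by apply/funext => s; exact: E.
rewrite E; apply: is_deriveD.
  exact: is_derive_scalel.
exact: is_derive_scalel.
Qed.

(** * Lifts of curves on the circle *)

Lemma circle_lift (psi : R -> circle R) (phi v : R -> R) :
  (forall t, circle_is_derive t psi (v t)) ->
  (forall t : R, is_derive t 1 phi (v t)) ->
  psi 0 = to_circle (phi 0) -> forall t, psi t = to_circle (phi t).
Proof.
move=> dpsi dphi psi0 t.
have reprE s r : psi s = to_circle r -> expi (repr (psi s)) = expi r.
  by move=> psisE; apply/expi_eq; rewrite -psisE; exact: reprK.
(* The local lifts of psi witnessing its velocity need not match at different
   times, but this cosine does not depend on the lift and has derivative 0. *)
pose c s := cos (repr (psi s) - phi s).
have dc (s : R) : is_derive s 1 c 0.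
  have [phi1 psiE dphi1] := dpsi s.
  have cE : \forall r \near s, cos (phi1 r - phi r) = c r.
    by apply: filterS psiE => r /reprE[cr sr]; rewrite /c !cosB cr sr.
  apply: (near_eq_is_derive cE); have dphis := dphi s.
  by apply: is_derive_eq; rewrite subrr mulr0.
(* The constant value of [c] is 1, read off at time 0. *)
have [k kE] : exists k : int, repr (psi t) - phi t = (pi *+ 2) *~ k.
  apply: cos_eq1; rewrite -/(c t) (is_derive_0_is_cst t 0 dc) /c.
  by rewrite cosB; have [-> ->] := reprE _ _ psi0; rewrite -!expr2 cos2Dsin2.
by rewrite -[LHS]reprK; apply/to_circle_eqP; exists k.
Qed.

Lemma to_circle0 : to_circle (0 : R) = 0.
Proof. exact: (raddf0 (\pi_(circle R)%qT)). Qed.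

Lemma to_circleD (x y : R) : to_circle (x + y) = to_circle x + to_circle y.
Proof. exact: (raddfD (\pi_(circle R)%qT)). Qed.

(** * Mean value estimates, tubes around compact sets and distance to a set *)

Lemma is_derive_le1_lipschitz (f df : R -> R) :
  (forall t : R, is_derive t 1 f (df t)) -> (forall t, `|df t| <= 1) ->
  forall x y, `|f x - f y| <= `|x - y|.
Proof.
move=> dfE df1 x y; wlog xy : x y / x <= y.
  move=> hw; case: (leP x y) => [/hw//|/ltW/hw].
  by rewrite distrC [leRHS]distrC.
have [|c _ fyx] := MVT_segment xy (fun t _ => dfE t).
  apply/continuous_subspaceT => t.
  by apply/differentiable_continuous/derivable1_diffP/ex_derive.
by rewrite distrC fyx normrM [leRHS]distrC ler_piMl.
Qed.

Lemma cos_lipschitz (x y : R) : `|cos x - cos y| <= `|x - y|.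
Proof.
by apply: (@is_derive_le1_lipschitz _ (fun t => - sin t)) => t; rewrite normrN sin_max.
Qed.

Lemma sin_lipschitz (x y : R) : `|sin x - sin y| <= `|x - y|.
Proof. by apply: (@is_derive_le1_lipschitz _ cos) => t; rewrite ?cos_max. Qed.

Lemma is_derive_le0_nincr (f df : R -> R) :
  (forall t : R, is_derive t 1 f (df t)) -> (forall t, df t <= 0) ->
  forall x y, x <= y -> f y <= f x.
Proof.
move=> dfE df0 x y xy.
apply: (@ler0_derive1_nincry _ f x) => // [t _|].
- by rewrite derive1E derive_val.
- apply/continuous_subspaceT => t.
  by apply/differentiable_continuous/derivable1_diffP/ex_derive.
Qed.

(** A Lebesgue number argument: of the radius available at s, one half pays for moving to a nearby
    parameter and the other half remains for the ball there; compactness makes one radius serve all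
    parameters. *)
Lemma set_nbhs_compact_ball (T : topologicalType) (M : pseudoMetricType R)
    (gam : T -> M) (K : set T) (U : set M) : compact K -> continuous gam ->
  set_nbhs (gam @` K) U ->
  exists2 r : R, 0 < r & forall s, K s -> ball (gam s) r `<=` U.
Proof.
move=> /compact_near_coveringP cK cgam nU.
have : \forall e \near (0 : R)^'+, K `<=` [set s | ball (gam s) e `<=` U].
  apply: cK => s Ks.
  have /nbhs_ballP[e /= e0 eU] := nU _ (ex_intro2 _ _ s Ks erefl).
  have e20 : 0 < e / 2 by rewrite divr_gt0.
  exists ([set s' | ball (gam s) (e / 2) (gam s')], [set r | r < e / 2]).
    split => /=; first by apply: cgam; exact: nbhsx_ballx.
    exact: nbhs_right_lt.
  move=> [s' r] /= [ss' re] m ms'; apply: eU.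
  rewrite [e]splitr; apply: ball_triangle ss' _.
  exact: le_ball (ltW re) _ ms'.
move=> nearK; near (0 : R)^'+ => r.
exists r; first by near: r; exact: nbhs_right_gt.
by near: r; exact: nearK.
Unshelve. all: by end_near. Qed.

(** The nearby point of [A] may change with time in any manner; a squeeze needs only the vanishing
    radius. *)
Lemma cvg_edist_inf_le (M : pseudoMetricType R) (A : set M) (u : R -> M)
    (r : R -> R) : r t @[t --> +oo] --> 0 ->
  (forall t, 0 <= t -> 0 < r t /\ exists2 p, A p & ball (u t) (r t) p) ->
  edist_inf A (u t) @[t --> +oo] --> 0%E.
Proof.
move=> r0 ru.
apply: (@squeeze_cvge _ _ _ _ (cst 0%E) _ (fun t => (r t)%:E)).
- near=> t; rewrite edist_inf_ge0/=.
  have [|rt [p Ap up]] := ru t; first by near: t; exact: nbhs_pinfty_ge.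
  apply: ge_ereal_inf; exists (edist (u t, p)); first by exists p.
  by apply: ge_ereal_inf; exists (r t)%:E => //; exists (r t).
- exact: cvg_cst.
- by apply/fine_cvgP; split; [exact: nearW|exact: r0].
Unshelve. all: by end_near. Qed.

End preliminaries.

(** * The system in real coordinates with a lifted phase *)

Section forced_rotation.
Context {R : realType}.
Variables eps Omega0 alpha Delta Omega PN kappa q : R.
Hypotheses (eps_gt0 : 0 < eps) (Omega0_gt0 : 0 < Omega0) (alpha_gt0 : 0 < alpha).

Let F := vector_field eps Omega0 alpha Delta Omega PN kappa q.
(** [wS] is the rest value of w, [a] the damping rate of z (half that of w), [b] the angular
    frequency of z and [g] the coefficient of its forcing. *)
Let wS := PN / alpha - Omega.
Let a := eps * alpha / 2.
Let b := Omega0 + eps * Delta.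
Let g := eps * (kappa * q / (2 * Omega0)).

Let a_gt0 : 0 < a. Proof. by rewrite /a divr_gt0// mulr_gt0. Qed.

Definition lifted_solution (x y phi w : R -> R) : Prop := forall t : R,
  [/\ is_derive t 1 x (- a * x t - b * y t - g * cos (phi t)),
      is_derive t 1 y (b * x t - a * y t - g * sin (phi t)),
      is_derive t 1 phi (Omega0 + eps * w t) &
      is_derive t 1 w (- (2 * a) * (w t - wS))].

Definition project (x y phi w : R) : phase_space R :=
  ((x +i* y)%C, to_circle phi, w).

Lemma vector_field_project x y phi w : F (project x y phi w) =
  (((- a * x - b * y - g * cos phi) +i* (b * x - a * y - g * sin phi))%C,
   Omega0 + eps * w, - (2 * a) * (w - wS)).
Proof.
rewrite /F /vector_field /project circle_expiE /expi; congr (_, _, _).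
  rewrite /g /a /b; move: (_ / (2 * Omega0)) => c.
  by apply/eqP; rewrite eq_complex/=; apply/andP;
    split; apply/eqP; field.
by rewrite /a /wS; field; exact: lt0r_neq0.
Qed.

Lemma lifted_solution_project x y phi w : lifted_solution x y phi w ->
  is_solution F (fun t => project (x t) (y t) (phi t) (w t)).
Proof.
move=> sol t; have [dx dy dphi dw] := sol t.
rewrite vector_field_project; split => //=; first exact: is_derive_complex.
exists phi; last exact: dphi.
by apply: filterE.
Qed.

(** The phase velocity depends on w alone, so a real phase can be written down explicitly, starting
    from any representative [phi0]; [circle_lift] then identifies it with the given phase. *)
Lemma is_solution_lift (u : R -> phase_space R) (phi0 : R) :
  is_solution F u -> (u 0).1.2 = to_circle phi0 ->
  exists x y phi w : R -> R, [/\ lifted_solution x y phi w, phi 0 = phi0 &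
    forall t, u t = project (x t) (y t) (phi t) (w t)].
Proof.
move=> sol u0.
pose x t := Re (u t).1.1; pose y t := Im (u t).1.1; pose w t := (u t).2.
(* An antiderivative of Omega0 + eps * w, since w - wS = - w' / (eps * alpha). *)
pose phi t := phi0 + (Omega0 + eps * wS) * t + (w 0 - w t) / alpha.
have phi00 : phi 0 = phi0 by rewrite /phi mulr0 subrr mul0r !addr0.
have F2 v : (F v).2 = - (2 * a) * (v.2 - wS) /\ (F v).1.2 = Omega0 + eps * v.2.
  by case: v => [[z psi] v] /=; split => //; rewrite /a /wS; field; exact: lt0r_neq0.
have dw (t : R) : is_derive t 1 w (- (2 * a) * (w t - wS)).
  by have [_ _] := sol t; rewrite (F2 _).1.
have dphi (t : R) : is_derive t 1 phi (Omega0 + eps * w t).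
  have dwt := dw t; apply: is_derive_eq.
  rewrite /GRing.scale/= /a; field; exact: lt0r_neq0.
have psiE t : (u t).1.2 = to_circle (phi t).
  apply: (circle_lift (psi := fun t => (u t).1.2)
    (v := fun t => Omega0 + eps * w t)) => //.
    by move=> s; have [_ + _] := sol s; rewrite (F2 _).2.
  by rewrite phi00.
have uE t : u t = project (x t) (y t) (phi t) (w t).
  move: (psiE t); rewrite /x /y /w /project.
  by case: (u t) => [[[zr zi] psi] v] /= ->.
exists x, y, phi, w; split => // t.
have [dz _ _] := sol t; rewrite uE vector_field_project/= in dz.
by split; [exact: (is_derive_Re dz)|exact: (is_derive_Im dz)|exact: dphi|exact: dw].
Qed.

(** * Uniqueness, existence and the flow *)

Lemma lifted_solution_unique x y phi w x' y' phi' w' :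
  lifted_solution x y phi w -> lifted_solution x' y' phi' w' ->
  [/\ x 0 = x' 0, y 0 = y' 0, phi 0 = phi' 0 & w 0 = w' 0] ->
  forall t, [/\ x t = x' t, y t = y' t, phi t = phi' t & w t = w' t].
Proof.
move=> sol sol' [x0 y0 phi0 w0] t.
(* The system is triangular: w is autonomous, phi is driven by w, and (x, y) by phi. At each stage
   the difference, weighted by an exponential where there is damping, is constant and starts at
   0. *)
have wE s : w s = w' s.
  pose d r := expR (2 * a * r) * (w r - w' r).
  have dd (r : R) : is_derive r 1 d 0.
    have [_ _ _ dw] := sol r; have [_ _ _ dw'] := sol' r.
    by apply: is_derive_eq; rewrite /GRing.scale/=; ring.
  apply/eqP; rewrite -subr_eq0; apply/eqP.
  have : d s = 0 by rewrite (is_derive_0_is_cst s 0 dd) /d w0 subrr mulr0.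
  by move/eqP; rewrite mulf_eq0 gt_eqF ?expR_gt0//= => /eqP.
have phiE s : phi s = phi' s.
  pose d r := phi r - phi' r.
  have dd (r : R) : is_derive r 1 d 0.
    have [_ _ dphi _] := sol r; have [_ _ dphi' _] := sol' r.
    by apply: is_derive_eq; rewrite wE subrr.
  apply/eqP; rewrite -subr_eq0 -/(d s).
  by rewrite (is_derive_0_is_cst s 0 dd) /d phi0 subrr.
(* With equal phases the forcing cancels, and the rotation preserves the norm; the weight offsets
   the remaining decay of the square at rate 2 a. *)
pose d r := expR (2 * a * r) * ((x r - x' r) ^+ 2 + (y r - y' r) ^+ 2).
have dd (r : R) : is_derive r 1 d 0.
  have [dx dy _ _] := sol r; have [dx' dy' _ _] := sol' r.
  by apply: is_derive_eq; rewrite /GRing.scale/= phiE; ring.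
have : d t = 0.
  by rewrite (is_derive_0_is_cst t 0 dd) /d x0 y0 !subrr expr0n/= addr0 mulr0.
move/eqP; rewrite mulf_eq0 gt_eqF ?expR_gt0//= paddr_eq0 ?sqr_ge0//.
by rewrite !sqrf_eq0 !subr_eq0 => /andP[/eqP-> /eqP->]; split.
Qed.

Lemma lifted_solution_exists x0 y0 phi0 w0 : exists x y phi w,
  lifted_solution x y phi w /\
  [/\ x 0 = x0, y 0 = y0, phi 0 = phi0 & w 0 = w0].
Proof.
pose w t := wS + (w0 - wS) * expR (- (2 * a) * t).
have dw (t : R) : is_derive t 1 w (- (2 * a) * (w t - wS)).
  by apply: is_derive_eq; rewrite /GRing.scale/= /w; ring.
have w00 : w 0 = w0 by rewrite /w mulr0 expR0; ring.
pose phi t := phi0 + (Omega0 + eps * wS) * t + (w0 - w t) / alpha.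
have dphi (t : R) : is_derive t 1 phi (Omega0 + eps * w t).
  have dwt := dw t; apply: is_derive_eq.
  rewrite /GRing.scale/= /a; field; exact: lt0r_neq0.
have phi00 : phi 0 = phi0 by rewrite /phi w00 mulr0 subrr mul0r !addr0.
have cont (h : R -> R) : (forall t : R, derivable h t 1) -> continuous h.
  by move=> dh t; apply/differentiable_continuous/derivable1_diffP.
pose p t := - g * (expR (a * t) * cos (phi t - b * t)).
pose r t := - g * (expR (a * t) * sin (phi t - b * t)).
(* Variation of constants: P + iQ = exp((a - ib)t) (x + iy) has a prescribed
   derivative. *)
have [P dP] : exists P : R -> R, forall t : R, is_derive t 1 P (p t).
  apply: continuous_antiderivative; apply: cont => t.
  by have dphit := dphi t; exact: ex_derive.
have [Q dQ] : exists Q : R -> R, forall t : R, is_derive t 1 Q (r t).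
  apply: continuous_antiderivative; apply: cont => t.
  by have dphit := dphi t; exact: ex_derive.
(* Constants are adjusted to the initial values; turning by b t and damping by exp(-a t) then leads
   back to (x, y). *)
pose X t := P t - P 0 + x0; pose Y t := Q t - Q 0 + y0.
pose x t := expR (- a * t) * (cos (b * t) * X t - sin (b * t) * Y t).
pose y t := expR (- a * t) * (sin (b * t) * X t + cos (b * t) * Y t).
(* Inserting exp(-a t) exp(a t) = 1 and splitting phi = b t + (phi - b t) brings the forcing to the
   form in which it arises from differentiating [x] and [y]. *)
have gE t c : g * c = expR (- a * t) * expR (a * t) * (g * c).
  by rewrite -expRD mulNr addNr expR0 mul1r.
have cosE t : cos (phi t) =
    cos (b * t) * cos (phi t - b * t) - sin (b * t) * sin (phi t - b * t).
  by rewrite -cosD addrC subrK.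
have sinE t : sin (phi t) =
    sin (b * t) * cos (phi t - b * t) + cos (b * t) * sin (phi t - b * t).
  by rewrite -sinD addrC subrK.
exists x, y, phi, w; split; last first.
  by rewrite /x /y /X /Y !mulr0 expR0 cos0 sin0; split => //; ring.
move=> t; have dPt := dP t; have dQt := dQ t; split => //.
  apply: is_derive_eq; rewrite /GRing.scale/= cosE.
  by rewrite (gE t) /p /r /x /y; ring.
apply: is_derive_eq; rewrite /GRing.scale/= sinE.
by rewrite (gE t) /p /r /x /y; ring.
Qed.

Lemma rotation0 (u : phase_space R) : rotation Omega0 0 u = u.
Proof.
case: u => [[z psi] w]; rewrite /rotation mulr0 /expi cos0 sin0.
by rewrite mul1r to_circle0 addr0.
Qed.

Lemma project_surj (u : phase_space R) :
  project (Re u.1.1) (Im u.1.1) (repr u.1.2) u.2 = u.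
Proof. by case: u => [[[x y] psi] w]; rewrite /project/= /to_circle reprK. Qed.

Lemma solution_exists u0 : exists u, is_solution F u /\ u 0 = u0.
Proof.
have [x [y [phi [w [sol [x0 y0 phi0 w0]]]]]] :=
  lifted_solution_exists (Re u0.1.1) (Im u0.1.1) (repr u0.1.2) u0.2.
exists (fun t => project (x t) (y t) (phi t) (w t)); split.
  exact: lifted_solution_project.
by rewrite x0 y0 phi0 w0 project_surj.
Qed.

Lemma solution_unique u u' : is_solution F u -> is_solution F u' ->
  u 0 = u' 0 -> u = u'.
Proof.
move=> sol sol' u0.
(* Both lifts start at the canonical representative of the common initial phase, so they agree at
   time 0 in R and not merely modulo 2 pi. *)
have reprE (v : phase_space R) : v.1.2 = to_circle (repr v.1.2) by rewrite /to_circle reprK.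
have [x [y [phi [w [lsol phi0 uE]]]]] := is_solution_lift sol (reprE (u 0)).
have [x' [y' [phi' [w' [lsol' phi'0 u'E]]]]] :=
  is_solution_lift sol' (reprE (u' 0)).
apply/funext => t; rewrite uE u'E.
have [|-> -> -> -> //] := lifted_solution_unique lsol lsol' _ t.
by have := u0; rewrite uE u'E phi0 phi'0 u0 => -[-> -> ->].
Qed.

Lemma flow_exists : exists Phi, is_flow F Phi.
Proof.
have [U HU] := choice solution_exists.
exists (fun t u0 => U u0 t); split=> [u0|u]; first by have [] := HU u0.
have [solU U0] := HU (u 0).
split=> [sol t|uE]; first by rewrite -(solution_unique sol solU).
by rewrite (_ : u = U (u 0))//; exact/funext.
Qed.

(** * The relative equilibrium as a rotating solution *)

Variables psiS xS : R.
(** Real and imaginary parts of the balance g exp(i psiS) = (-a + i eps (Delta - wS)) xS, which says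
    that z is at rest in the frame turning with velocity Omega0 + eps wS. *)
Hypothesis gcosE : g * cos psiS = - (a * xS).
Hypothesis gsinE : g * sin psiS = eps * xS * (Delta - wS).

Let uS : phase_space R := (xS%:C%C, to_circle psiS, wS).
Let O := group_orbit Omega0 uS.

Let gcosDE th : g * cos (psiS + th) =
  - (a * xS) * cos th - eps * xS * (Delta - wS) * sin th.
Proof. by rewrite cosD mulrBr !mulrA gcosE gsinE. Qed.

Let gsinDE th : g * sin (psiS + th) =
  eps * xS * (Delta - wS) * cos th - a * xS * sin th.
Proof. by rewrite sinD mulrDr !mulrA gcosE gsinE mulNr. Qed.

Lemma rotation_uS th : rotation Omega0 th uS =
  project (xS * cos (Omega0 * th)) (xS * sin (Omega0 * th)) (psiS + Omega0 * th) wS.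
Proof.
rewrite /uS /rotation /project to_circleD; congr (_, _, _).
by apply/eqP; rewrite eq_complex/=; apply/andP; split; apply/eqP; ring.
Qed.

Lemma orbit_project th :
  O (project (xS * cos th) (xS * sin th) (psiS + th) wS).
Proof.
exists (th / Omega0) => //.
by rewrite rotation_uS (_ : Omega0 * (th / Omega0) = th)// mulrC divfK// gt_eqF.
Qed.

Let xi := 1 + eps / Omega0 * wS.

(** The balance at [psiS] is equivariant, and Omega0 xi = Omega0 + eps wS is the phase velocity at w
    = wS. The offset [th] covers every point of the orbit. *)
Lemma rotating_solution th :
  is_solution F (fun t => rotation Omega0 (xi * t + th) uS).
Proof.
pose th' t := Omega0 * (xi * t + th).
have dth (t : R) : is_derive t 1 th' (Omega0 + eps * wS).
  apply: is_derive_eq; rewrite /GRing.scale/= /xi; field; exact: lt0r_neq0.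
rewrite (_ : (fun _ => _) = (fun t => project (xS * cos (th' t))
  (xS * sin (th' t)) (psiS + th' t) wS)); last first.
  by apply/funext => t; rewrite rotation_uS.
apply: lifted_solution_project.
move=> t; have dtht := dth t.
(* The first summand is the rotation of the solution itself; the second is the detuning, which the
   forcing cancels. *)
have Eb : b = (Omega0 + eps * wS) + eps * (Delta - wS) by rewrite /b; ring.
split; apply: is_derive_eq; rewrite /GRing.scale/=.
- by rewrite gcosDE -/b Eb; ring.
- by rewrite gsinDE -/b Eb; ring.
- by rewrite add0r mul1r.
- by rewrite subrr mulr0.
Qed.

(** * The Lyapunov function and its comparison with the distance to the orbit *)

Let k := eps * xS / a.

(** The state is compared with the orbit point of the same phase, so the phase itself contributes
    nothing. The weight on w is large enough to absorb the coupling of w into z. *)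
Definition lyapunov (x y phi w : R) : R :=
  (x - xS * cos (phi - psiS)) ^+ 2 + (y - xS * sin (phi - psiS)) ^+ 2 +
  (1 + k ^+ 2) * (w - wS) ^+ 2.

Lemma lyapunov_decay x y phi w : lifted_solution x y phi w ->
  forall t, 0 <= t -> lyapunov (x t) (y t) (phi t) (w t) <=
    expR (- a * t) * lyapunov (x 0) (y 0) (phi 0) (w 0).
Proof.
move=> sol t t0.
pose th s := phi s - psiS; pose v s := w s - wS.
pose X s := x s - xS * cos (th s); pose Y s := y s - xS * sin (th s).
have kE : eps * xS = a * k by rewrite /k mulrCA divff ?mulr1// gt_eqF.
have phiE s : phi s = psiS + th s by rewrite /th addrC subrK.
have bE : b = (Omega0 + eps * wS) + eps * (Delta - wS) by rewrite /b; ring.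
(* The comparison point turns with velocity Omega0 + eps w instead of Omega0 + eps wS; the excess
   eps v times the radius xS is the forcing a k v. *)
have dX (s : R) : is_derive s 1 X (- a * X s - b * Y s + a * k * v s * sin (th s)).
  have [dx _ dphi _] := sol s; apply: is_derive_eq.
  rewrite /GRing.scale/= -/a -/b -/g phiE gcosDE -kE -/(th s) /X /Y /v bE; ring.
have dY (s : R) : is_derive s 1 Y (b * X s - a * Y s - a * k * v s * cos (th s)).
  have [_ dy dphi _] := sol s; apply: is_derive_eq.
  rewrite /GRing.scale/= -/a -/b -/g phiE gsinDE -kE -/(th s) /X /Y /v bE; ring.
have dv (s : R) : is_derive s 1 v (- (2 * a) * v s).
  by have [_ _ _ dw] := sol s; apply: is_derive_eq; rewrite subr0.
pose L s := X s ^+ 2 + Y s ^+ 2 + (1 + k ^+ 2) * v s ^+ 2.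
(* n and m are the coordinates of (X, Y) in the frame rotating with th; only m
   couples to v, and completing the square in m - k v makes D nonpositive. *)
pose m s := X s * sin (th s) - Y s * cos (th s).
pose n s := X s * cos (th s) + Y s * sin (th s).
have mnE s : X s ^+ 2 + Y s ^+ 2 = n s ^+ 2 + m s ^+ 2.
  transitivity ((X s ^+ 2 + Y s ^+ 2) * (cos (th s) ^+ 2 + sin (th s) ^+ 2)).
    by rewrite cos2Dsin2 mulr1.
  by rewrite /n /m; ring.
pose D s := - (expR (a * s) * (a *
  (n s ^+ 2 + (m s - k * v s) ^+ 2 + (3 + 2 * k ^+ 2) * v s ^+ 2))).
have dL (s : R) : is_derive s 1 (fun s => expR (a * s) * L s) (D s).
  have dXs := dX s; have dYs := dY s; have dvs := dv s; apply: is_derive_eq.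
  (* The terms in b cancel in the derivative of X^2 + Y^2, so the only cross term is the one between
     v and m. *)
  rewrite /GRing.scale/=.
  transitivity (- (expR (a * s) * (a * ((X s ^+ 2 + Y s ^+ 2) -
      2 * k * v s * m s + 3 * (1 + k ^+ 2) * v s ^+ 2)))).
    by rewrite /L /m; ring.
  by rewrite mnE /D; ring.
have D0 s : D s <= 0.
  rewrite oppr_le0 mulr_ge0 ?expR_ge0// mulr_ge0 ?(ltW a_gt0)//.
  by rewrite !addr_ge0 ?sqr_ge0// mulr_ge0 ?sqr_ge0// addr_ge0// mulr_ge0 ?sqr_ge0.
have := is_derive_le0_nincr dL D0 t0.
rewrite mulr0 expR0 mul1r mulNr expRN.
by rewrite mulrC -ler_pdivlMr ?expR_gt0// mulrC.
Qed.

Lemma lyapunov_ge0 x y phi w : 0 <= lyapunov x y phi w.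
Proof. by rewrite !addr_ge0 ?sqr_ge0// mulr_ge0 ?sqr_ge0// addr_ge0 ?sqr_ge0. Qed.

(** At the orbit point of the same phase the circle component has distance 0, and the squares of the
    other two distances are each bounded by L, since its weight is at least 1. *)
Lemma ball_lyapunov (r x y phi w : R) : 0 < r -> lyapunov x y phi w < r ^+ 2 ->
  exists2 p, O p & ball (project x y phi w) r p.
Proof.
move=> r0 Lr; pose th := phi - psiS.
have phiE : phi = psiS + th by rewrite /th addrC subrK.
exists (project (xS * cos th) (xS * sin th) (psiS + th) wS).
  exact: orbit_project.
have v0 : (w - wS) ^+ 2 <= (1 + k ^+ 2) * (w - wS) ^+ 2.
  by rewrite ler_peMl ?sqr_ge0// lerDl sqr_ge0.
split; first split => /=.
- rewrite -ball_normE /= Rcomplex_normE/=.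
  rewrite -[ltRHS]ger0_norm ?ltW// -sqrtr_sqr ltr_sqrt ?exprn_gt0//.
  apply: le_lt_trans Lr; rewrite /lyapunov lerDl.
  exact: le_trans (sqr_ge0 _) v0.
- by rewrite phiE; exact: ballxx.
- rewrite -ball_normE /=.
  rewrite -ltr_sqr ?nnegrE ?normr_ge0 ?ltW// real_normK ?num_real//.
  apply: le_lt_trans Lr; apply: le_trans v0 _.
  by rewrite lerDr addr_ge0 ?sqr_ge0.
Qed.

Lemma lyapunov_ball (r : R) : 0 < r -> exists2 d : R, 0 < d &
  forall p u, O p -> ball p d u -> exists x y phi w,
    u = project x y phi w /\ lyapunov x y phi w < r ^+ 2.
Proof.
(* Within d of an orbit point, X and Y are at most (1 + |xS|) d: one d for z, and |xS| d for passing
   to the orbit point of the same phase. Hence L <= M d^2, and d = r / (M + 1) makes this less than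
   r^2. *)
move=> r0; have [M ME M1] : exists2 M : R,
    M = (1 + `|xS|) ^+ 2 + (1 + `|xS|) ^+ 2 + (1 + k ^+ 2) & 1 <= M.
  by eexists; first reflexivity; rewrite ler_wpDl ?addr_ge0 ?sqr_ge0// lerDl sqr_ge0.
have M0 : 0 < M by exact: lt_le_trans M1.
have [d d0 rE] : exists2 d : R, 0 < d & r = d * (M + 1).
  exists (r / (M + 1)); first by rewrite divr_gt0// addr_gt0.
  by rewrite divfK// gt_eqF// addr_gt0.
exists d => //; have Mdr : M * d ^+ 2 < r ^+ 2.
  rewrite rE exprMn (mulrC M) ltr_pM2l ?exprn_gt0//.
  have : 0 < M ^+ 2 + M + 1 by rewrite !addr_gt0 ?exprn_gt0.
  by rewrite -subr_gt0; congr (_ < _); ring.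
move=> _ [[[x y] psi] w] [th0 _ <-]; rewrite rotation_uS.
move: (Omega0 * th0) => th [[/= zd psid] wd].
(* Representatives less than d apart: [al1] for the phase of the orbit point, [al2] for that of the
   given state. *)
have [al1 [al2 [al1E al2E al12]]] := psid.
have [cE sE] : expi (al1 - psiS) = expi th.
  apply/expi_eq; rewrite [RHS](_ : _ = to_circle (psiS + th - psiS)).
    by rewrite to_circleD al1E -to_circleD.
  by rewrite addrAC subrr add0r.
exists x, y, al2, w; split; first by rewrite /project al2E.
rewrite -ball_normE /= in zd; rewrite -ball_normE /= in wd.
have Xd : `|x - xS * cos (al2 - psiS)| <= (1 + `|xS|) * d.
  rewrite (_ : _ - _ = (x - xS * cos th) + xS * (cos th - cos (al2 - psiS))); last by ring.
  rewrite (le_trans (ler_normD _ _))// mulrDl mul1r lerD//.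
    rewrite distrC (le_trans _ (ltW zd))//.
    by apply: le_trans (ler_Re_norm _).
  rewrite normrM ler_wpM2l// -cE (le_trans (cos_lipschitz _ _))//.
  by rewrite opprB addrA subrK ltW.
have Yd : `|y - xS * sin (al2 - psiS)| <= (1 + `|xS|) * d.
  rewrite (_ : _ - _ = (y - xS * sin th) + xS * (sin th - sin (al2 - psiS))); last by ring.
  rewrite (le_trans (ler_normD _ _))// mulrDl mul1r lerD//.
    rewrite distrC (le_trans _ (ltW zd))//.
    by apply: le_trans (ler_Im_norm _).
  rewrite normrM ler_wpM2l// -sE (le_trans (sin_lipschitz _ _))//.
  by rewrite opprB addrA subrK ltW.
have sq_le (z c : R) : `|z| <= c -> z ^+ 2 <= c ^+ 2.
  by move=> zc; rewrite -(real_normK (num_real z)) lerXn2r ?nnegrE// (le_trans _ zc).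
apply: le_lt_trans Mdr.
rewrite (_ : M * _ = ((1 + `|xS|) * d) ^+ 2 + ((1 + `|xS|) * d) ^+ 2 +
  (1 + k ^+ 2) * d ^+ 2); last by rewrite ME; ring.
rewrite lerD//; first by rewrite lerD// sq_le.
rewrite ler_wpM2l//; first by rewrite addr_ge0 ?sqr_ge0.
by rewrite sq_le// distrC ltW.
Qed.

(** Reduction modulo 2 pi exhibits the orbit as the image of the compact segment [0, 2 pi] under a
    continuous curve, whence a uniform radius. *)
Lemma orbit_thickening (U : set (phase_space R)) : set_nbhs O U ->
  exists2 r : R, 0 < r & forall p, O p -> ball p r `<=` U.
Proof.
pose gam (th : R) : phase_space R :=
  project (xS * cos th) (xS * sin th) (psiS + th) wS.
have gamO : gam @` `[0, pi *+ 2] `<=` O by move=> _ [th _ <-]; exact: orbit_project.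
have Ogam p : O p -> exists2 th, th \in `[0, pi *+ 2] & p = gam th.
  move=> [th0 _ <-]; rewrite rotation_uS.
  have [n [th [thE /andP[th_ge0 th_lt]]]] := mod2pi (Omega0 * th0).
  exists th; first by rewrite in_itv/= th_ge0 ltW.
  have [cE sE] := expi_periodic th n.
  rewrite thE /gam /project cE sE; congr (_, _, _).
  by apply/to_circle_eqP; exists n; ring.
pose z (th : R) : Rcomplex R := (xS * cos th +i* (xS * sin th))%C.
have cz : continuous z.
  move=> th; apply/differentiable_continuous/derivable1_diffP.
  have dz : is_derive th 1 z (- xS * sin th +i* (xS * cos th))%C.
    by apply: is_derive_complex; apply: is_derive_eq; rewrite /GRing.scale/=; ring.
  exact: ex_derive.
have cgam : continuous gam.
  move=> th; apply/cvg_ballP => e e0.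
  apply: filterS2 (cvg_ball (cz th) e0) (nbhsx_ballx th e e0) => th' zth' thth'.
  split; [split=> //|exact: ballxx].
  exists (psiS + th), (psiS + th'); split => //.
  by rewrite opprD addrACA subrr add0r.
move=> nU; have [] := set_nbhs_compact_ball (@segment_compact _ 0 (pi *+ 2)) cgam (U := U).
  by move=> p /gamO; exact: nU.
move=> r r0 rU; exists r => // p /Ogam[th thI ->]; exact: rU.
Qed.

(** * Invariance and asymptotic stability of the orbit under the flow *)

Variable Phi : R -> phase_space R -> phase_space R.
Hypothesis flowPhi : is_flow F Phi.

Lemma flow_solution v : is_solution F (fun t => Phi t v).
Proof. by apply/flowPhi.2 => t; rewrite flowPhi.1. Qed.

Lemma flow_rotation t th :
  Phi t (rotation Omega0 th uS) = rotation Omega0 (xi * t + th) uS.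
Proof. by have /flowPhi.2 -> := rotating_solution th; rewrite mulr0 add0r. Qed.

Lemma flow_relative_equilibrium : relative_equilibrium Omega0 Phi xi uS.
Proof. by move=> t; rewrite -[in LHS](rotation0 uS) flow_rotation addr0. Qed.

Lemma flow_lyapunov x0 y0 phi0 w0 t : 0 <= t -> exists x y phi w,
  Phi t (project x0 y0 phi0 w0) = project x y phi w /\
  lyapunov x y phi w <= expR (- a * t) * lyapunov x0 y0 phi0 w0.
Proof.
move=> t0; set v := project _ _ _ _.
have [|x [y [phi [w [sol phi00 uE]]]]] := is_solution_lift (flow_solution v) (phi0 := phi0).
  by rewrite flowPhi.1.
have := uE 0; rewrite flowPhi.1 /v phi00 => -[x0E y0E w0E].
exists (x t), (y t), (phi t), (w t); split; first exact: uE.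
by rewrite x0E y0E -phi00 w0E; exact: lyapunov_decay.
Qed.

Lemma orbit_asymptotically_stable :
  transversely_asymptotically_stable Omega0 Phi uS.
Proof.
split=> [t|U /orbit_thickening[r r0 rU]].
  apply/seteqP; split=> [_ [_ [th _ <-] <-]|_ [th _ <-]].
    by exists (xi * t + th); rewrite ?flow_rotation.
  exists (rotation Omega0 (th - xi * t) uS); first by exists (th - xi * t).
  by rewrite flow_rotation addrC subrK.
(* A sublevel set of the Lyapunov function: it is a neighbourhood of the orbit by [lyapunov_ball],
   decay keeps solutions in it, and [ball_lyapunov] puts it inside the tube of radius r. *)
pose V : set (phase_space R) := [set v | exists x y phi w,
  v = project x y phi w /\ lyapunov x y phi w < r ^+ 2].
exists V => [p Op|_ [x0 [y0 [phi0 [w0 [-> L0r]]]]]].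
  have [d d0 dV] := lyapunov_ball r0.
  by apply/nbhs_ballP; exists d => // u; exact: dV.
set L0 := lyapunov x0 y0 phi0 w0 in L0r; split=> [t t0|].
  have [x [y [phi [w [-> L]]]]] := flow_lyapunov x0 y0 phi0 w0 t0.
  have [|p Op /ball_sym up] := @ball_lyapunov r x y phi w r0; last exact: rU up.
  rewrite (le_lt_trans L)// (le_lt_trans _ L0r)// ler_piMl ?lyapunov_ge0//.
  by rewrite -expR0 ler_expR mulNr oppr_le0 mulr_ge0// ltW.
have L00 : 0 <= L0 := lyapunov_ge0 x0 y0 phi0 w0.
(* The rate is a / 2 because L bounds a squared distance; L0 + 1 keeps the radius positive and the
   bound strict even when L0 = 0. *)
apply: (@cvg_edist_inf_le _ _ _ _
    (fun t => Num.sqrt (L0 + 1) * expR (- (a / 2 * t)))).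
  rewrite -[X in _ --> X](mulr0 (Num.sqrt (L0 + 1))); apply: cvgMr.
  apply: (cvg_comp (fun t => a / 2 * t) (fun t => expR (- t))); last exact: cvgr_expR.
  by apply: gt0_cvgMry; [rewrite divr_gt0|exact: cvg_id].
move=> t t0; split.
  by rewrite mulr_gt0 ?expR_gt0// sqrtr_gt0 ltr_wpDl.
have [x [y [phi [w [-> L]]]]] := flow_lyapunov x0 y0 phi0 w0 t0.
apply: ball_lyapunov; first by rewrite mulr_gt0 ?expR_gt0// sqrtr_gt0 ltr_wpDl.
apply: le_lt_trans L _.
rewrite exprMn sqr_sqrtr ?(addr_ge0 L00)//.
rewrite expr2 -expRD (_ : - (a / 2 * t) + - (a / 2 * t) = - a * t); last by field.
by rewrite mulrC ltr_pM2r ?expR_gt0// ltrDl.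
Qed.

End forced_rotation.

(** * The explicit equilibrium satisfies the balance equations *)

Theorem proposition7p2 (R : realType)
    (eps Omega0 alpha Delta Omega PN kappa q : R)
    (eps_gt0 : 0 < eps) (Omega0_gt0 : 0 < Omega0)
    (kq_neq0 : kappa * q != 0) (alpha_gt0 : 0 < alpha) :
  let F := vector_field eps Omega0 alpha Delta Omega PN kappa q in
  let wS := PN / alpha - Omega in
  let S := Num.sqrt (alpha ^+ 2 + 4 * (wS - Delta) ^+ 2) in
  let xS := `|kappa * q| / (Omega0 * S) in
  let xi := 1 + eps / Omega0 * wS in
  forall psiS : R,
    cos psiS = - Num.sg (kappa * q) * (alpha / S) ->
    sin psiS = - Num.sg (kappa * q) * (2 * (wS - Delta) / S) ->
    let uS : phase_space R := (xS%:C%C, to_circle psiS, wS) in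
    exists Phi : R -> phase_space R -> phase_space R,
      [/\ is_flow F Phi,
          relative_equilibrium Omega0 Phi xi uS,
          uS.1.1 != 0 &
          transversely_asymptotically_stable Omega0 Phi uS].
Proof.
move=> F wS S xS xi psiS cosE sinE uS.
have S_gt0 : 0 < S.
  by rewrite sqrtr_gt0 ltr_pwDl ?exprn_gt0// mulr_ge0 ?sqr_ge0.
have xS_gt0 : 0 < xS by rewrite divr_gt0 ?normr_gt0// mulr_gt0.
(* The sign in the formulas for [psiS] turns kappa q into |kappa q| = Omega0 S xS, and the factor S
   then cancels the denominators of cos and sin. *)
have xSE : eps * (kappa * q / (2 * Omega0)) * Num.sg (kappa * q) =
    eps / 2 * (S * xS).
  rewrite /xS normrEsg; field; by rewrite !lt0r_neq0.
have gcosE : eps * (kappa * q / (2 * Omega0)) * cos psiS =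
    - (eps * alpha / 2 * xS).
  by rewrite cosE mulNr mulrN (mulrA _ (Num.sg _)) xSE; field; exact: lt0r_neq0.
have gsinE : eps * (kappa * q / (2 * Omega0)) * sin psiS =
    eps * xS * (Delta - wS).
  by rewrite sinE mulNr mulrN (mulrA _ (Num.sg _)) xSE; field; exact: lt0r_neq0.
have [Phi flowPhi] : exists Phi, is_flow F Phi by exact: flow_exists.
exists Phi; split => //.
- exact: (flow_relative_equilibrium _ _ gcosE gsinE flowPhi).
- by rewrite /= eq_complex/= eqxx andbT gt_eqF.
- exact: (orbit_asymptotically_stable _ _ _ gcosE gsinE flowPhi).
Qed.
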